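(* Fix integers $k\geq2$, $d\geq1$ and $1\leq m\leq d$, where $k\geq3$ when $d=1$. Fix a real number $0<\epsilon<1/8$. Let $N=\lceil1/(8\epsilon)\rceil$, let $0<\delta\leq1/24$, and let $A$ be a nonempty subset of $\{0,1,\ldots,N-1\}^d$ which does not contain any arithmetic patches of size $k$ with orientation $\{e_1,\ldots,e_m\}$. For all $a\in A$ and $x\in\mathbb{R}^d$ define \[ \phi_a(x)=\frac{\delta}{N-1+\delta}\,x+a . \] Let $F$ be the attractor of the iterated function system $(\phi_a)_{a\in A}$, i.e. the nonempty compact set with $F=\bigcup_{a\in A}\phi_a(F)$. Then the following hold: (i) the iterated function system $\{\phi_a : a\in A\}$ satisfies the open set condition; (ii) $F$ does not contain any $(k,\epsilon,\{e_1,\ldots,e_m\})$-APs; (iii) \[\dim_{\mathrm{H}}F=\frac{\log|A|}{\log\left(\frac{N-1}{\delta}+1\right)}.\]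
   Context: $e_i$ denotes the vector in $\mathbb{R}^d$ whose $i$-th coordinate is $1$ and whose other coordinates are $0$. Let $\mathbf{v}=\{v_1,\ldots,v_m\}$ be a set of $m$ pairwise orthogonal unit vectors in $\mathbb{R}^d$. For a positive integer $k$ and $\Delta>0$, a set $P\subset\mathbb{R}^d$ is an arithmetic patch of size $k$ and scale $\Delta$ with orientation $\mathbf{v}$ if $P=\{t+\Delta\sum_{i=1}^m x_iv_i : x_i=0,1,\ldots,k-1\}$ for some $t\in\mathbb{R}^d$ (when no scale is mentioned, any $\Delta>0$ is allowed). For $\epsilon\in[0,1/2)$, a set $Q\subset\mathbb{R}^d$ is a $(k,\epsilon,\mathbf{v})$-AP if there is an arithmetic patch $P$ of size $k$ and some scale $\Delta>0$ with orientation $\mathbf{v}$ such that $\sup_{x\in P}\inf_{y\in Q}\|x-y\|\leq\epsilon\Delta$ (Euclidean norm). A set contains a $(k,\epsilon,\mathbf{v})$-AP if some subset of it is a $(k,\epsilon,\mathbf{v})$-AP. An iterated function system on $\mathbb{R}^d$ is a finite set $\{f_1,\ldots,f_n\}$ of contractions of $\mathbb{R}^d$. It satisfies the open set condition if there is a nonempty bounded open set $V\subset\mathbb{R}^d$ such that $V\supseteq\bigcup_{i=1}^n f_i(V)$ with the union pairwise disjoint. $\dim_{\mathrm{H}}$ is the Hausdorff dimension and $|A|$ the cardinality of $A$. *)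

(* Defs.v *)
From HB Require Import structures.
From mathcomp Require Import all_boot all_order all_algebra.
From mathcomp Require Import all_classical all_reals all_analysis.
Set Implicit Arguments.
Unset Strict Implicit.
Unset Printing Implicit Defensive.
Import Order.TTheory GRing.Theory Num.Theory.
Import numFieldNormedType.Exports.
Local Open Scope classical_set_scope.
Local Open Scope ring_scope.

(* The canonical norm `|x| on 'rV[R]_d is the sup norm, so metric notions are
   stated with the Euclidean norm below.  Topological notions (open, compact,
   bounded_set) use the library's structure, since the two norms are
   equivalent. *)
Definition dotp (R : realType) (d : nat) (x y : 'rV[R]_d) : R :=
  \sum_(i < d) x 0 i * y 0 i.

Definition enorm (R : realType) (d : nat) (x : 'rV[R]_d) : R :=
  Num.sqrt (dotp x x).

Record orientation (R : realType) (d m : nat) := Orientation {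
  ovec :> 'I_m -> 'rV[R]_d ;
  ovec_unit : forall i, enorm (ovec i) = 1 ;
  ovec_orthogonal : forall i j, i != j -> dotp (ovec i) (ovec j) = 0
}.

Section StdOrientation.
Variables (R : realType) (d m : nat) (hmd : (m <= d)%N).

Definition std_vec (i : 'I_m) : 'rV[R]_d := delta_mx 0 (widen_ord hmd i).

Lemma dotp_std_vec (i j : 'I_m) : dotp (std_vec i) (std_vec j) = (i == j)%:R.
Proof.
rewrite /dotp (bigD1 (widen_ord hmd i)) //= big1 ?addr0 => [|l li].
  by rewrite !mxE !eqxx mul1r.
by rewrite !mxE (negbTE li) andbF mul0r.
Qed.

Lemma std_vec_unit (i : 'I_m) : enorm (std_vec i) = 1.
Proof. by rewrite /enorm dotp_std_vec eqxx sqrtr1. Qed.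

Lemma std_vec_orthogonal (i j : 'I_m) :
  i != j -> dotp (std_vec i) (std_vec j) = 0.
Proof. by rewrite dotp_std_vec => /negbTE ->. Qed.

Definition std_orientation : orientation R d m :=
  Orientation std_vec_unit std_vec_orthogonal.

End StdOrientation.

Definition is_patch (R : realType) (d m k : nat) (Delta : R)
    (v : orientation R d m) (P : set 'rV[R]_d) : Prop :=
  exists t : 'rV[R]_d,
    P = [set t + Delta *: (\sum_(i < m) (x i)%:R *: v i)
        | x in [set: {ffun 'I_m -> 'I_k}]].

Definition contains_patch (R : realType) (d m k : nat)
    (v : orientation R d m) (S : set 'rV[R]_d) : Prop :=
  exists Delta P, [/\ 0 < Delta, is_patch k Delta v P & P `<=` S].

(* The supremum and infimum are taken in \bar R, so that the infimum over an
   empty Q is +oo (it would be 0 in R). *)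
Definition is_AP (R : realType) (d m k : nat) (eps : R)
    (v : orientation R d m) (Q : set 'rV[R]_d) : Prop :=
  exists Delta P, [/\ 0 < Delta, is_patch k Delta v P &
    (ereal_sup [set ereal_inf [set (enorm (x - y))%:E | y in Q] | x in P]
      <= (eps * Delta)%:E)%E].

Definition contains_AP (R : realType) (d m k : nat) (eps : R)
    (v : orientation R d m) (S : set 'rV[R]_d) : Prop :=
  exists Q, Q `<=` S /\ is_AP k eps v Q.

Definition contracting (R : realType) (d : nat) (f : 'rV[R]_d -> 'rV[R]_d)
    : Prop :=
  exists c : R, [/\ 0 <= c, c < 1 &
    forall x y, enorm (f x - f y) <= c * enorm (x - y)].

Definition is_IFS (R : realType) (d : nat)
    (Phi : set ('rV[R]_d -> 'rV[R]_d)) : Prop :=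
  finite_set Phi /\ (forall f, Phi f -> contracting f).

Definition open_set_condition (R : realType) (d : nat)
    (Phi : set ('rV[R]_d -> 'rV[R]_d)) : Prop :=
  exists V : set 'rV[R]_d,
    [/\ V !=set0, bounded_set V, open V,
        \bigcup_(f in Phi) (f @` V) `<=` V &
        trivIset Phi (fun f => f @` V)].

Definition is_attractor (R : realType) (d : nat)
    (Phi : set ('rV[R]_d -> 'rV[R]_d)) (F : set 'rV[R]_d) : Prop :=
  [/\ F !=set0, compact F & F = \bigcup_(f in Phi) (f @` F)].

Section Hausdorff.
Variables (R : realType) (d : nat).
Local Open Scope ereal_scope.

(* Equal to -oo on the empty set. *)
Definition ediam (U : set 'rV[R]_d) : \bar R :=
  ereal_sup [set (enorm (p.1 - p.2)%R)%:E | p in U `*` U].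

(* diam(U)^s, with the usual conventions at s = 0: the empty set contributes 0
   and every nonempty set contributes 1. *)
Definition diam_pow (s : R) (U : set 'rV[R]_d) : \bar R :=
  if U == set0 then 0 else ediam U `^ s.

Definition hausdorff_premeasure (s rho : R) (E : set 'rV[R]_d) : \bar R :=
  ereal_inf [set \sum_(n <oo) diam_pow s (U n)
            | U in [set U : nat -> set 'rV[R]_d |
                E `<=` \bigcup_n U n /\ forall n, ediam (U n) <= rho%:E]].

Definition hausdorff_measure (s : R) (E : set 'rV[R]_d) : \bar R :=
  ereal_sup [set hausdorff_premeasure s rho E | rho in [set rho | (0 < rho)%R]].

Definition hausdorff_dim (E : set 'rV[R]_d) : \bar R :=
  ereal_inf [set s%:E | s in [set s | (0 <= s)%R /\ hausdorff_measure s E = 0]].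

End Hausdorff.

Definition grid_point (R : realType) (N d : nat) (a : 'rV['I_N]_d) : 'rV[R]_d :=
  \row_j (a 0 j)%:R.

Definition phi (R : realType) (N d : nat) (delta : R) (a : 'rV['I_N]_d)
    (x : 'rV[R]_d) : 'rV[R]_d :=
  (delta / (N%:R - 1 + delta)) *: x + grid_point R a.

(* Main.v *)
(* Write c = delta / (N - 1 + delta).  The attractor lies in the cube
   [0, N - 1 + delta]^d, so its first-level copies lie in the cubes
   a + [0, delta]^d, a in A, which are separated since delta < 1.  Consider
   points of F lying within e * D of a patch of scale D, where
   e = 1 / (8 (N - 1)) > eps.  As F has side at most N - 1 + delta, the error
   e * D + delta is too small for the first digits, which are integers, to be
   anything but an exact patch (possibly of scale 0); A being patch-free, they
   are all equal, and zooming in on their common copy gives such a near-patch of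
   scale D / c.  Iterating contradicts the boundedness of F.  The dimension is
   the similarity dimension s, given by |A| c^s = 1: the |A|^n level-n copies
   bound it from above, and the lower bound is a direct induction on finite
   covers, which separation splits into covers of the individual copies. *)
Require Import Defs.
From HB Require Import structures.
From mathcomp Require Import all_boot all_order all_algebra.
From mathcomp Require Import all_classical all_reals all_analysis.
From mathcomp Require Import ring lra.
Import Order.TTheory GRing.Theory Num.Theory.
Import numFieldNormedType.Exports.
Local Open Scope classical_set_scope.
Local Open Scope ring_scope.

(** * Euclidean norm, Hausdorff measure and open cubes *)

Section EuclideanNorm.
Context {R : realType} {d : nat}.
Implicit Types x y : 'rV[R]_d.

Lemma enormZ (c : R) x : enorm (c *: x) = `|c| * enorm x.
Proof.
rewrite /enorm -sqrtr_sqr -sqrtrM ?sqr_ge0//; congr Num.sqrt.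
by rewrite /dotp mulr_sumr; apply: eq_bigr => i _; rewrite !mxE; ring.
Qed.

Lemma coord_le_enorm x j : `|x 0 j| <= enorm x.
Proof.
rewrite -sqrtr_sqr ler_wsqrtr// /dotp (bigD1 j)//= expr2 lerDl.
by apply: sumr_ge0 => i _; rewrite -expr2 sqr_ge0.
Qed.

Lemma enorm_le x (B : R) : 0 <= B -> (forall j, `|x 0 j| <= B) ->
  enorm x <= Num.sqrt d%:R * B.
Proof.
move=> B0 xB; rewrite -[B]ger0_norm// -sqrtr_sqr -sqrtrM ?ler0n//.
rewrite ler_wsqrtr// /dotp.
have -> : d%:R * B ^+ 2 = \sum_(i < d) B ^+ 2.
  by rewrite sumr_const card_ord mulr_natl.
apply: ler_sum => i _; rewrite -expr2 -real_normK ?num_real//.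
by rewrite lerXn2r ?nnegrE.
Qed.

Lemma ediam_ge0 (U : set 'rV[R]_d) : U !=set0 -> (0 <= ediam U)%E.
Proof.
case=> u Uu; apply: ereal_sup_ubound; exists (u, u) => //=.
by rewrite subrr -(scale0r 0) enormZ normr0 mul0r.
Qed.

Lemma le_ediam (U : set 'rV[R]_d) x y :
  U x -> U y -> ((enorm (x - y))%:E <= ediam U)%E.
Proof. by move=> Ux Uy; apply: ereal_sup_ubound; exists (x, y). Qed.

Lemma diam_pow_ge0 (s : R) (U : set 'rV[R]_d) : (0 <= diam_pow s U)%E.
Proof. by rewrite /diam_pow; case: ifP => // _; exact: poweR_ge0. Qed.

Lemma hausdorff_premeasure_ge0 (s rho : R) (E : set 'rV[R]_d) :
  (0 <= hausdorff_premeasure s rho E)%E.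
Proof.
apply: le_ereal_inf_tmp => _ [U _ <-].
by apply: nneseries_ge0 => n _ _; exact: diam_pow_ge0.
Qed.

Lemma hausdorff_measure_eq0 (s : R) (E : set 'rV[R]_d) :
  hausdorff_measure s E = 0%E <->
  forall rho, 0 < rho -> hausdorff_premeasure s rho E = 0%E.
Proof.
split=> [E0 rho rho0|E0]; apply/eqP; rewrite eq_le.
  rewrite hausdorff_premeasure_ge0 andbT -E0.
  by apply: ereal_sup_ubound; exists rho.
apply/andP; split.
  by apply: ge_ereal_sup => _ [rho /= rho0 <-]; rewrite E0.
(* A supremum is at least any of its members; the member at scale 1 vanishes. *)
rewrite -(E0 1 ltr01); apply: ereal_sup_ubound; exists 1 => //=.
Qed.

Lemma open_box (a b : R) : open [set x : 'rV[R]_d | forall j, a < x 0 j < b].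
Proof.
rewrite openE => x xab.
have xj (j : 'I_d) : nbhs x [set y : 'rV[R]_d | y 0 j \in `]a, b[].
  have /coord_continuous xI : nbhs (x 0 j) [set` `]a, b[].
    apply: open_nbhs_nbhs; split; first exact: interval_open.
    by rewrite /= in_itv/=.
  exact: xI.
apply: filterS (filter_forall _ xj) => y ay j.
by have := ay j; rewrite /= in_itv.
Qed.

Lemma bounded_box (a b : R) :
  bounded_set [set x : 'rV[R]_d | forall j, a < x 0 j < b].
Proof.
exists (Num.max `|a| `|b|); split; first exact: num_real.
move=> M; rewrite gt_max => /andP[aM bM] x xab.
rewrite /= [leLHS]/Num.norm/= mx_normrE; apply: bigmax_le => [|[i j] _ /=].
  exact: le_trans (ltW aM).
rewrite (ord1 i) ler_norml.
have /andP[ax xb] := xab j.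
move: aM bM; rewrite !ltr_norml => /andP[aM _] /andP[_ bM].
by rewrite (ltW (lt_trans aM ax)) (ltW (lt_trans xb bM)).
Qed.

End EuclideanNorm.

(** * The similarities, the open set condition and the bounding cube *)

Section GridSystem.
Context {R : realType} {N d : nat} {delta : R}.
Hypotheses (N1 : (1 < N)%N) (delta0 : 0 < delta) (delta1 : delta < 1).
Local Notation c := (delta / (N%:R - 1 + delta)).
Local Notation L := (N%:R - 1 + delta).
Local Notation box := [set x : 'rV[R]_d | forall j, 0 <= x 0 j <= L].
Implicit Types (a b : 'rV['I_N]_d) (A : {set 'rV['I_N]_d}).
Implicit Types (x y : 'rV[R]_d) (F : set 'rV[R]_d).

Lemma param_bounds : [/\ 1 <= N%:R - 1 :> R, 0 < delta & delta < 1].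
Proof. by split=> //; rewrite lerBrDr (ler_nat _ 2). Qed.

Lemma ratio_gt0 : 0 < c.
Proof. by have [? ? ?] := param_bounds; rewrite divr_gt0//; lra. Qed.

Lemma ratio_lt1 : c < 1.
Proof. by have [? ? ?] := param_bounds; rewrite ltr_pdivrMr; lra. Qed.

(** This identity dictates the ratio: copies of the cube have side [delta], those with digits 0 and
    [N - 1] touch opposite faces of the cube, and neighbouring ones leave gaps [1 - delta]. *)
Lemma ratio_side : c * L = delta.
Proof. by have [? ? ?] := param_bounds; rewrite divfK// gt_eqF//; lra. Qed.

Lemma phiE a x j : phi delta a x 0 j = c * x 0 j + (a 0 j)%:R.
Proof. by rewrite /phi !mxE. Qed.

Lemma phi_sub a x y : phi delta a x - phi delta a y = c *: (x - y).
Proof. by rewrite /phi scalerBr opprD addrACA subrr addr0. Qed.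

Lemma digit_ge0_le a j : 0 <= (a 0 j)%:R :> R /\ (a 0 j)%:R <= N%:R - 1 :> R.
Proof.
by split; rewrite ?ler0n ?lerBrDr ?natr1 ?ler_nat ?ltn_ord.
Qed.

(** Distinct digits differ by at least 1, and the offsets [c * u] and [c * v] both lie in
    [[0, delta]]. *)
Lemma digit_separation a b (u v : R) j : 0 <= u <= L -> 0 <= v <= L ->
  `|(c * u + (a 0 j)%:R) - (c * v + (b 0 j)%:R)| < 1 - delta ->
  a 0 j = b 0 j.
Proof.
move=> /andP[u0 uL] /andP[v0 vL].
have c0 := ratio_gt0; have [_ d0 d1] := param_bounds.
have := ratio_side.
have : c * u <= c * L by rewrite ler_wpM2l// ltW.
have : c * v <= c * L by rewrite ler_wpM2l// ltW.
have : 0 <= c * u by rewrite mulr_ge0// ltW.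
have : 0 <= c * v by rewrite mulr_ge0// ltW.
(* Abstracting the products leaves a linear problem. *)
move: (c * u) (c * v) (c * L) => cu cv cL cv0 cu0 cvL cuL eL.
rewrite ltr_norml => /andP[h1 h2].
apply/val_inj; case: (ltngtP (a 0 j) (b 0 j)) => //.
  by rewrite -(ler_nat R) -natr1 => ab; exfalso; lra.
by rewrite -(ler_nat R) -natr1 => ab; exfalso; lra.
Qed.

Lemma phi_is_IFS A : is_IFS [set phi delta a | a in [set` A]].
Proof.
split; first exact/finite_image/finite_finset.
move=> _ [a _ <-]; exists c; split; [exact/ltW/ratio_gt0|exact: ratio_lt1|].
by move=> x y; rewrite phi_sub enormZ gtr0_norm// ratio_gt0.
Qed.

Lemma phi_open_set_condition A :
  open_set_condition [set phi delta a | a in [set` A]].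
Proof.
have [? ? ?] := param_bounds.
(* The interior of the bounding cube serves as the open set; its images are the open cubes of side
   [delta] at the points of [A]. *)
exists [set x : 'rV[R]_d | forall j, 0 < x 0 j < L]; split.
- by exists (const_mx (L / 2)) => j; rewrite mxE; apply/andP; split; lra.
- exact: bounded_box.
- exact: open_box.
- move=> _ [_ [a _ <-]] [x x01 <-] j; rewrite phiE.
  have /andP[x0 x1] := x01 j; have [a0 a1] := digit_ge0_le a j.
  have := ratio_side.
  have : c * x 0 j < c * L by rewrite ltr_pM2l// ratio_gt0.
  have : 0 < c * x 0 j by rewrite mulr_gt0// ratio_gt0.
  by move: (c * _) (c * _) => u v *; apply/andP; split; lra.
- move=> _ _ [a _ <-] [b _ <-] [_ [[x xL <-] [y yL yx]]].
  suff -> : a = b by [].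
  apply/rowP => j; have := xL j; have := yL j.
  move=> /andP[/ltW y0 /ltW y1] /andP[/ltW x0 /ltW x1].
  apply: (@digit_separation a b (x 0 j) (y 0 j) j); rewrite ?x0 ?x1 ?y0 ?y1//.
  by rewrite -!phiE yx subrr normr0; lra.
Qed.

Lemma attractor_digit {A F x} :
  is_attractor [set phi delta a | a in [set` A]] F -> F x ->
  exists a y, [/\ a \in A, F y & x = phi delta a y].
Proof.
by case=> _ _ {1}-> [_ [a aA <-] [y Fy <-]]; exists a, y.
Qed.

Lemma attractor_phi {A F a y} :
  is_attractor [set phi delta a | a in [set` A]] F -> a \in A -> F y ->
  F (phi delta a y).
Proof.
by case=> _ _ FE aA Fy; rewrite FE; exists (phi delta a); [exists a|exists y].
Qed.

(** By compactness each coordinate has extrema on [F]. An extremal point is the image of a point of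
    [F], so the maximum [p] satisfies [p <= c * p + (N - 1)], whence [p <= (N - 1) / (1 - c) = L];
    the minimum [q] satisfies [q >= c * q], whence [q >= 0]. *)
Lemma attractor_box {A F} :
  is_attractor [set phi delta a | a in [set` A]] F -> F `<=` box.
Proof.
move=> hF x Fx j; have [F0 cF _] := hF.
have cj : {within F, continuous (fun y : 'rV[R]_d => y 0 j)}.
  by apply: continuous_subspaceT => y; exact: coord_continuous.
have c0 := ratio_gt0; have c1 := ratio_lt1; have cL := ratio_side.
have [_ d0 _] := param_bounds.
have [p /set_mem Fp pmax] := EVT_max_rV F0 cF cj.
have [q /set_mem Fq qmin] := EVT_min_rV F0 cF cj.
apply/andP; split.
  apply: le_trans (qmin x (mem_set Fx)).
  have [a [y [_ /mem_set/qmin qy qE]]] := attractor_digit hF Fq.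
  have [a0 _] := digit_ge0_le a j.
  have : c * q 0 j <= c * y 0 j by rewrite ler_pM2l.
  have : q 0 j = c * y 0 j + (a 0 j)%:R by rewrite -phiE -qE.
  move: (c * y 0 j) (q 0 j) => u v -> h.
  have : 0 <= (1 - c) * (u + (a 0 j)%:R) by nra.
  by rewrite pmulr_rge0 ?subr_gt0.
apply: le_trans (pmax x (mem_set Fx)) _.
have [a [y [_ /mem_set/pmax yp pE]]] := attractor_digit hF Fp.
have [_ a1] := digit_ge0_le a j.
have : c * y 0 j <= c * p 0 j by rewrite ler_pM2l.
have : p 0 j = c * y 0 j + (a 0 j)%:R by rewrite -phiE -pE.
move=> pE' h.
have : 0 <= (1 - c) * (L - p 0 j) by nra.
by rewrite pmulr_rge0 ?subr_gt0 ?subr_ge0.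
Qed.

End GridSystem.

Lemma exists_expr_lt {R : realType} {z : R} (eps : R) : 0 <= z < 1 -> 0 < eps ->
  exists n, z ^+ n < eps.
Proof.
move=> /andP[z0 z1] eps0; have zn : `|z| < 1 by rewrite ger0_norm.
have /cvgrPdist_lt/(_ _ eps0)[n _ /(_ n (leqnn n))] := cvg_expr zn.
by rewrite sub0r normrN ger0_norm ?exprn_ge0//; exists n.
Qed.

Lemma natr_eq_of_dist_lt1 {R : realType} (p q : nat) :
  `|p%:R - q%:R| < 1 :> R -> p = q.
Proof.
rewrite ltr_norml => /andP[h1 h2].
by case: (ltngtP p q) => //; rewrite -(ler_nat R) -natr1 => ?; exfalso; lra.
Qed.

(** * Near-patches in the attractor and their rescaling *)

Section Patches.
Context {R : realType} {N d m k : nat} {delta e : R} {hmd : (m <= d)%N}.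
Hypotheses (N1 : (1 < N)%N) (delta0 : 0 < delta) (delta24 : delta <= 1 / 24).
Hypotheses (m0 : (0 < m)%N) (k1 : (1 < k)%N).
Hypothesis eN : e * (N%:R - 1) = 1 / 8.
Local Notation c := (delta / (N%:R - 1 + delta)).
Local Notation L := (N%:R - 1 + delta).
Local Notation index := {ffun 'I_m -> 'I_k}.
Local Notation v := (std_orientation R hmd).

Definition lattice_point (x : index) : 'rV[R]_d := \sum_(i < m) (x i)%:R *: v i.

Lemma lattice_point_widen x i : lattice_point x 0 (widen_ord hmd i) = (x i)%:R.
Proof.
rewrite /lattice_point summxE (bigD1 i)//= !mxE !eqxx mulr1 big1 ?addr0//.
move=> l li; rewrite !mxE (_ : (widen_ord hmd i == _) = false) ?andbF ?mulr0//.
by apply/negbTE; rewrite -val_eqE /= val_eqE eq_sym.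
Qed.

Lemma lattice_point_out x (j : 'I_d) : (m <= j)%N -> lattice_point x 0 j = 0.
Proof.
move=> mj; rewrite /lattice_point summxE big1// => l _.
rewrite !mxE (_ : (j == _) = false) ?andbF ?mulr0//.
by apply/negbTE; rewrite -val_eqE /= gtn_eqF// (leq_trans (ltn_ord l)).
Qed.

(** The error is bounded coordinatewise, which follows from a Euclidean bound and lets digits be
    compared one coordinate at a time. Being proportional to [D], it is preserved by
    similarities. *)
Definition near_patch (F : set 'rV[R]_d) (D : R) (t : 'rV[R]_d)
    (y : index -> 'rV[R]_d) :=
  forall x, F (y x) /\
    forall j, `|y x 0 j - (t 0 j + D * lattice_point x 0 j)| <= e * D.

(** [x0] is the corner of the index cube and [x1] its neighbour along the first axis; this pair
    reveals the scale. *)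
Let x0 : index := [ffun=> Ordinal (ltnW k1)].
Let i0 : 'I_m := Ordinal m0.
Let x1 : index := [ffun i => if i == i0 then Ordinal k1 else Ordinal (ltnW k1)].

Let delta1 : delta < 1. Proof. by have := delta24 => ?; lra. Qed.

Let e_bounds : 0 < e <= 1 / 8.
Proof.
have N2 : 1 <= N%:R - 1 :> R by rewrite lerBrDr (ler_nat _ 2).
by have := eN => h; apply/andP; split; nra.
Qed.

(** The points indexed by [x0] and [x1] lie in a cube of side [L], but their first coordinates
    differ by at least [D - 2 * e * D]. *)
Lemma near_patch_scale {F : set 'rV[R]_d} {D t y} :
  (forall z, F z -> forall j, 0 <= z 0 j <= L) -> near_patch F D t y ->
  D * (1 - 2 * e) <= L.
Proof.
move=> FL nF; have [F0 h0] := nF x0; have [F1 h1] := nF x1.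
have := h0 (widen_ord hmd i0); have := h1 (widen_ord hmd i0).
have /andP[+ _] := FL _ F0 (widen_ord hmd i0).
have /andP[_ +] := FL _ F1 (widen_ord hmd i0).
rewrite !lattice_point_widen !ffunE eqxx /= mulr0 mulr1 !ler_norml.
by move=> ? ? /andP[? ?] /andP[? ?]; lra.
Qed.

Context {A : {set 'rV['I_N]_d}} {F : set 'rV[R]_d}.
Hypothesis hF : is_attractor [set phi delta a | a in [set` A]] F.
Hypothesis patch_free :
  ~ contains_patch k v [set grid_point R a | a in [set` A]].

(* Up to an error less than 2/5 the first digits of the points of a near-patch
   form a patch, so that, being integers, they form a patch, which is trivial
   as [A] is patch-free. *)
Lemma near_patch_digits {D t y} {a : index -> 'rV['I_N]_d}
    {z : index -> 'rV[R]_d} :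
  0 < D -> near_patch F D t y ->
  (forall x, [/\ a x \in A, F (z x) & y x = phi delta (a x) (z x)]) ->
  forall x, a x = a x0.
Proof.
move=> D0 nF az; have Fbox := attractor_box N1 delta0 delta1 hF.
have [N2 d0 _] := param_bounds N1 delta0 delta1.
have DL := near_patch_scale Fbox nF.
have [//|nall] := pselect (forall x, a x = a x0).
(* As [1 - 2 * e >= 3 / 4], one gets [e * D <= 4 / 3 * (e * L)], where
   [e * L = 1 / 8 + e * delta <= 25 / 192]. The left side is thus at most
   [1 / 24 + 25 / 72 = 7 / 18]. *)
have slack : delta + 2 * (e * D) < 2 / 5.
  have /andP[e0 e8] := e_bounds; have eN' := eN; have d24 := delta24.
  have h : e * (D * (1 - 2 * e)) <= e * L by rewrite ler_pM2l.
  have : e * D * (3 / 4) <= e * D * (1 - 2 * e).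
    by rewrite ler_pM2l ?mulr_gt0//; lra.
  have : e * delta <= 1 / 8 * (1 / 24) by rewrite ler_pM// ltW.
  rewrite mulrA in h; rewrite [e * L]mulrDr eN' in h; lra.
pose digit x j : nat := a x 0 j.
(* The offsets inside the two copies contribute at most [delta], the two near-patch errors
   [2 * (e * D)]. Two such estimates combine to an error below [4 / 5 < 1], which determines an
   integer. *)
have digit_diff x x' j :
    `|(digit x j)%:R - (digit x' j)%:R
      - D * (lattice_point x 0 j - lattice_point x' 0 j)| < 2 / 5.
  have [_ Fz yE] := az x; have [_ Fz' yE'] := az x'.
  have [_ /(_ j)] := nF x; have [_ /(_ j)] := nF x'.
  rewrite /digit yE yE' !phiE.
  have /andP[z0 zL] := Fbox _ Fz j; have /andP[z0' zL'] := Fbox _ Fz' j.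
  have c0 := ratio_gt0 N1 delta0 delta1.
  have := ratio_side N1 delta0 delta1.
  have : c * z x 0 j <= c * L by rewrite ler_pM2l.
  have : c * z x' 0 j <= c * L by rewrite ler_pM2l.
  have : 0 <= c * z x 0 j by rewrite mulr_ge0// ltW.
  have : 0 <= c * z x' 0 j by rewrite mulr_ge0// ltW.
  move: (c * z x 0 j) (c * z x' 0 j) (c * L) => u u' w u'0 u0 u'w uw wE.
  rewrite mulrBr; move: slack; move: (e * D) => eD slack.
  rewrite !ler_norml ltr_norml => /andP[? ?] /andP[? ?].
  by apply/andP; split; lra.
have out x (j : 'I_d) : (m <= j)%N -> a x 0 j = a x0 0 j.
  move=> mj; apply/val_inj/(@natr_eq_of_dist_lt1 R).
  have := digit_diff x x0 j; rewrite !lattice_point_out// subrr mulr0 subr0.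
  by move=> h; apply: lt_trans h _; lra.
pose w0 := widen_ord hmd i0.
have x1w : lattice_point x1 0 w0 - lattice_point x0 0 w0 = 1.
  by rewrite !lattice_point_widen !ffunE eqxx /= subr0.
(* As [D > 0], the difference of these digits exceeds [- 2 / 5], so it is nonnegative and the
   truncated subtraction in [s] is a true one. *)
have step : (digit x0 w0 <= digit x1 w0)%N.
  have := digit_diff x1 x0 w0; rewrite x1w mulr1 ltr_norml => /andP[h1 _].
  by case: leqP => //; rewrite -(ler_nat R) -natr1 => ?; exfalso; lra.
pose s := (digit x1 w0 - digit x0 w0)%N.
have sE : s%:R = (digit x1 w0)%:R - (digit x0 w0)%:R :> R by rewrite natrB.
(* Lowering one index coordinate by 1 changes the digit by [D] up to [2 / 5], exactly as passing
   from [x1] to [x0] does; hence the step is [s] along every axis. *)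
have inn (i : 'I_m) n (x : index) : x i = n :> nat ->
    digit x (widen_ord hmd i) = (digit x0 (widen_ord hmd i) + s * n)%N.
  elim: n x => [|n IH] x xi.
    rewrite muln0 addn0; apply: (@natr_eq_of_dist_lt1 R).
    have := digit_diff x x0 (widen_ord hmd i).
    rewrite !lattice_point_widen xi ffunE /= subrr mulr0 subr0.
    by move=> h; apply: lt_trans h _; lra.
  have nk : (n < k)%N by apply: ltn_trans (ltn_ord (x i)); rewrite xi.
  pose x' : index := [ffun l => if l == i then Ordinal nk else x l].
  have x'i : x' i = n :> nat by rewrite ffunE eqxx.
  rewrite mulnS (addnC s) addnA -(IH x')//.
  apply: (@natr_eq_of_dist_lt1 R); rewrite natrD sE.
  have := digit_diff x1 x0 w0; rewrite x1w.
  have := digit_diff x x' (widen_ord hmd i).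
  rewrite !lattice_point_widen xi x'i (_ : n.+1%:R - n%:R = 1); last first.
    by rewrite -natr1 addrAC subrr add0r.
  rewrite !mulr1.
  by rewrite !ltr_norml => /andP[? ?] /andP[? ?]; apply/andP; split; lra.
have digitE x :
    grid_point R (a x) = grid_point R (a x0) + s%:R *: lattice_point x.
  apply/rowP => j; rewrite !mxE; have [jm|mj] := ltnP j m.
    have -> : j = widen_ord hmd (Ordinal jm) by apply: val_inj.
    rewrite lattice_point_widen -[a x 0 _ : nat]/(digit x _).
    by rewrite (inn _ _ _ erefl) natrD natrM.
  by rewrite lattice_point_out// mulr0 addr0 out.
(* A positive [s] would be the scale of a genuine patch in [A]. *)
have s0 : s = 0%N.
  apply: contrapT => /eqP; rewrite -lt0n => s0; apply: patch_free.
  exists s%:R, [set grid_point R (a x0) + s%:R *: lattice_point x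
               | x in [set: index]]; split.
  - by rewrite ltr0n.
  - by exists (grid_point R (a x0)).
  - by move=> _ [x _ <-]; exists (a x); [have [] := az x|exact: digitE].
exfalso; apply: nall => x; apply/rowP => j; apply: val_inj.
have /rowP/(_ j) := digitE x; rewrite s0 scale0r addr0 !mxE => /eqP.
by rewrite eqr_nat => /eqP.
Qed.

Lemma near_patch_rescale {D t y} : 0 < D -> near_patch F D t y ->
  exists t' y', near_patch F (D / c) t' y'.
Proof.
move=> D0 nF.
have /choice[a /choice[z az]] : forall x, exists a z,
    [/\ a \in A, F z & y x = phi delta a z].
  by move=> x; have [/(attractor_digit hF)] := nF x.
have aE := near_patch_digits D0 nF az.
have c0 := ratio_gt0 N1 delta0 delta1.
exists (c^-1 *: (t - grid_point R (a x0))), z => x; have [_ Fz yE] := az x.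
split=> // j; have [_ /(_ j)] := nF x.
rewrite yE aE phiE !mxE; move: c c0 => r r0 h.
have -> : z x 0 j - (r^-1 * (t 0 j - (a x0 0 j)%:R)
     + D / r * lattice_point x 0 j) = r^-1 * (r * z x 0 j + (a x0 0 j)%:R
     - (t 0 j + D * lattice_point x 0 j)).
  by field; rewrite gt_eqF.
by rewrite normrM gtr0_norm ?invr_gt0// mulrA mulrC ler_pM2r ?invr_gt0.
Qed.

(** Repeated rescaling yields scales [D / c ^+ n], which are unbounded, against
    [near_patch_scale]. *)
Lemma no_near_patch D t y : 0 < D -> ~ near_patch F D t y.
Proof.
move=> D0 nF.
have c0 := ratio_gt0 N1 delta0 delta1; have c1 := ratio_lt1 N1 delta0 delta1.
have /andP[e0 e8] := e_bounds.
have [n] : exists n, c ^+ n < D * (1 - 2 * e) / L.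
  apply: exists_expr_lt; first by rewrite (ltW c0).
  have N2 : 1 <= N%:R - 1 :> R by rewrite lerBrDr (ler_nat _ 2).
  have d0 := delta0.
  by rewrite divr_gt0// ?mulr_gt0//; lra.
have [t' [y' {}nF]] : exists t' y', near_patch F (D / c ^+ n) t' y'.
  elim: n => [|n [t' [y' nF']]]; first by exists t, y; rewrite expr0 divr1.
  have [|t'' [y'' nF'']] := near_patch_rescale _ nF'.
    by rewrite divr_gt0 ?exprn_gt0.
  by exists t'', y''; rewrite exprSr invfM mulrA.
have := near_patch_scale (attractor_box N1 delta0 delta1 hF) nF.
have L0 : 0 < L by have [? ? _] := param_bounds N1 delta0 delta1; lra.
by rewrite ltr_pdivlMr// mulrAC ler_pdivrMr ?exprn_gt0// leNgt mulrC => /negP.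
Qed.

End Patches.

(** * From approximate patches to near-patches *)

Section PatchFree.
Context {R : realType} {N d m k : nat} {delta eps : R} {hmd : (m <= d)%N}.
Hypotheses (N1 : (1 < N)%N) (delta0 : 0 < delta) (delta24 : delta <= 1 / 24).
Hypotheses (m0 : (0 < m)%N) (k1 : (1 < k)%N).
Hypothesis epsN : eps * (N%:R - 1) < 1 / 8.
Context {A : {set 'rV['I_N]_d}} {F : set 'rV[R]_d}.
Hypothesis hF : is_attractor [set phi delta a | a in [set` A]] F.
Hypothesis patch_free : ~ contains_patch k (std_orientation R hmd)
  [set grid_point R a | a in [set` A]].

Lemma attractor_no_AP : ~ contains_AP k eps (std_orientation R hmd) F.
Proof.
move=> [Q [QF [D [P [D0 [t PE] supP]]]]].
(* The strict inequality [eps < e] leaves room to choose an actual point of [Q] although the infimum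
   need not be attained. *)
pose e : R := 1 / 8 / (N%:R - 1).
have N2 : 1 <= N%:R - 1 :> R by rewrite lerBrDr (ler_nat _ 2).
have N0 : 0 < N%:R - 1 :> R by lra.
have eN : e * (N%:R - 1) = 1 / 8 by rewrite /e divfK// gt_eqF.
have epse : eps < e by rewrite -(ltr_pM2r N0) eN.
pose p x := t + D *: @lattice_point R d m k hmd x.
have /choice[y yP] : forall x : {ffun 'I_m -> 'I_k}, exists y,
    Q y /\ enorm (p x - y) < e * D.
  move=> x; have : (ereal_inf [set (enorm
      (p x - y))%:E | y in Q] < (e * D)%:E)%E.
    apply: (@le_lt_trans _ _ (eps * D)%:E); last by rewrite lte_fin ltr_pM2r.
    apply: le_trans supP; apply: ereal_sup_ubound.
    by exists (p x) => //; rewrite PE; exists x.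
  by move=> /ereal_inf_lt[_ [y Qy <-]]; rewrite lte_fin => ?; exists y.
apply: (@no_near_patch R N d m k delta e hmd N1 delta0 delta24 m0 k1 eN A F
  hF patch_free D t y D0) => x.
have [/QF Fy h] := yP x; split=> // j.
rewrite distrC; apply: le_trans (ltW h).
by apply: le_trans (coord_le_enorm _ j); rewrite !mxE.
Qed.

End PatchFree.

(** * Lower bound for the Hausdorff dimension *)

Lemma ler_sum_uniq {R : numDomainType} r (g : nat -> R) n :
  uniq r -> (forall i, i \in r -> (i < n)%N) -> (forall i, 0 <= g i) ->
  \sum_(i <- r) g i <= \sum_(0 <= i < n) g i.
Proof.
move=> ur rn g0; rewrite [leRHS](bigID (mem r) predT)/=.
have -> : \sum_(i <- r) g i = \sum_(0 <= i < n | i \in r) g i.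
  rewrite -[RHS]big_filter; apply: perm_big; apply: uniq_perm => //.
    by rewrite filter_uniq// iota_uniq.
  move=> i; rewrite mem_filter mem_index_iota /=.
  by case: (boolP (i \in r)) => //= /rn ->.
by rewrite lerDl sumr_ge0.
Qed.

Lemma sum_half_lt {R : realType} (e : R) n : 0 < e ->
  \sum_(0 <= i < n) e / 2 ^+ i.+1 < e.
Proof.
move=> e0; suff -> : \sum_(0 <= i < n) e / 2 ^+ i.+1 = e - e / 2 ^+ n.
  by rewrite ltrBlDr ltrDl divr_gt0// exprn_gt0.
elim: n => [|n IH]; first by rewrite big_geq// expr0 divr1 subrr.
rewrite big_nat_recr//= IH exprS; field.
by rewrite expf_neq0.
Qed.

Section HausdorffDimension.
Context {R : realType} {N d : nat} {delta : R}.
Hypotheses (N1 : (1 < N)%N) (delta0 : 0 < delta) (delta1 : delta < 1).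
Local Notation c := (delta / (N%:R - 1 + delta)).
Local Notation L := (N%:R - 1 + delta).
Context {A : {set 'rV['I_N]_d}} {F : set 'rV[R]_d}.
Hypothesis hF : is_attractor [set phi delta a | a in [set` A]] F.
Local Notation dimF := (ln (#|A|%:R) / ln ((N%:R - 1) / delta + 1)).

Let c0 : 0 < c := ratio_gt0 N1 delta0 delta1.
Let c1 : c < 1 := ratio_lt1 N1 delta0 delta1.

Let cardA_gt0 : 0 < #|A|%:R :> R.
Proof.
have [[x Fx] _ _] := hF; have [a [_ [aA _ _]]] := attractor_digit hF Fx.
by rewrite ltr0n; apply/card_gt0P; exists a.
Qed.

Let lnE : ln ((N%:R - 1) / delta + 1) = - ln c.
Proof.
rewrite -lnV ?posrE// invf_div; congr ln.
by rewrite [RHS]mulrDl divff// gt_eqF.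
Qed.

Let ln_c_lt0 : ln c < 0.
Proof. by rewrite ln_lt0// c0 c1. Qed.

Lemma dim_ge0 : 0 <= dimF.
Proof.
rewrite divr_ge0//; first by rewrite ln_ge0// ler1n -(ltr0n R).
by rewrite lnE oppr_ge0 ltW.
Qed.

(** Moran's equation: the denominator of [dimF] is [- ln c]. *)
Lemma card_powR_dim : #|A|%:R * c `^ dimF = 1.
Proof.
rewrite /powR gt_eqF// lnE invrN mulrN mulNr divfK ?lt_eqF//.
by rewrite expRN lnK ?posrE// divff// gt_eqF.
Qed.

(* Sets of diameter less than [1 - delta] meet at most one first-level copy of
   [F]; pulling back along the corresponding map multiplies diameters by
   [c^-1], and [n] such steps make some diameter at least [1 - delta]. *)
Lemma finite_cover_sum (s : R) n r (U : nat -> set 'rV[R]_d)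
    (rad : nat -> R) :
  0 <= s -> #|A|%:R * c `^ s = 1 ->
  (forall i, i \in r -> c ^+ n * (1 - delta) <= rad i) ->
  (forall i x y j, i \in r -> U i x -> U i y -> `|x 0 j - y 0 j| <= rad i) ->
  (forall x, F x -> exists2 i, i \in r & U i x) ->
  (1 - delta) `^ s <= \sum_(i <- r) rad i `^ s.
Proof.
move=> s0 As.
have d1 : 0 < 1 - delta by rewrite subr_gt0.
have large (l : seq nat) (f : nat -> R) i : i \in l -> 1 - delta <= f i ->
    (1 - delta) `^ s <= \sum_(i <- l) f i `^ s.
  move=> il di; rewrite (big_rem i)//= -[leLHS]addr0; apply: lerD.
    by rewrite ge0_ler_powR// nnegrE ?(ltW d1)// (le_trans _ di)// ltW.
  by apply: sumr_ge0 => ? _; exact: powR_ge0.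
elim: n r U rad => [|n IH] r U rad radn Urad UF.
  (* At depth 0 every set is large, and there is one because [F] is nonempty. *)
  have [[x /UF[i ir _]] _ _] := hF; apply: (large _ _ i ir).
  by have := radn i ir; rewrite expr0 mul1r.
have [[i ir di]|small] := pselect (exists2 i, i \in r & 1 - delta <= rad i).
  exact: large ir di.
pose hits i (a : 'rV['I_N]_d) := `[< exists x, F x /\ U i (phi delta a x) >].
have hits_inj i a b : i \in r -> hits i a -> hits i b -> a = b.
  move=> ir /asboolP[x [Fx Ux]] /asboolP[y [Fy Uy]]; apply/rowP => j.
  apply: (@digit_separation R N d delta N1 delta0 delta1 a b (x 0 j) (y 0 j) j).
  - exact: attractor_box hF _ Fx j.
  - exact: attractor_box hF _ Fy j.
  rewrite -!phiE; apply: le_lt_trans (Urad _ _ _ j ir Ux Uy) _.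
  by rewrite ltNge; apply/negP => h; apply: small; exists i.
have rad0 i : i \in r -> 0 <= rad i.
  by move=> /radn; apply: le_trans; rewrite mulr_ge0 ?exprn_ge0// ltW.
(* Pulling back replaces [rad i] by [rad i / c] and so multiplies its [s]-th power by [#|A|]. *)
have cV : (c^-1) `^ s = #|A|%:R.
  have : c `^ s * c^-1 `^ s = 1.
    by rewrite -powRM ?invr_ge0 ?(ltW c0)// divff ?powR1// gt_eqF.
  move/(congr1 ( *%R #|A|%:R)); rewrite mulrA As mul1r mulr1; exact.
have child a : a \in A ->
    (1 - delta) `^ s <= #|A|%:R * \sum_(i <- r | hits i a) rad i `^ s.
  move=> aA.
  have := IH [seq i <- r | hits i a] (fun i => phi delta a @^-1` U i)
    (fun i => rad i / c).
  rewrite big_filter mulr_sumr => h.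
  have -> : \sum_(i <- r | hits i a) #|A|%:R * rad i `^ s =
            \sum_(i <- r | hits i a) (rad i / c) `^ s.
    rewrite big_seq_cond [RHS]big_seq_cond; apply: eq_bigr => i /andP[ir _].
    by rewrite powRM ?invr_ge0 ?rad0 ?(ltW c0)// cV mulrC.
  apply: h.
  - move=> i; rewrite mem_filter => /andP[_ /radn radi].
    by rewrite ler_pdivlMr// mulrC mulrA -exprS.
  - move=> i x y j; rewrite mem_filter => /andP[_ ir] Ux Uy.
    have := Urad _ _ _ j ir Ux Uy; rewrite !phiE; move: c c0 => z z0.
    have -> : z * x 0 j + (a 0 j)%:R - (z * y 0 j + (a 0 j)%:R)
       = z * (x 0 j - y 0 j) by ring.
    by rewrite normrM gtr0_norm// ler_pdivlMr// mulrC.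
  - move=> x Fx; have [i ir Ui] := UF _ (attractor_phi hF aA Fx).
    by exists i => //; rewrite mem_filter ir andbT; apply/asboolP; exists x.
(* Summing [child] over [A] and exchanging the sums counts each [i] at most once, by [hits_inj]; the
   factor [#|A|] then cancels. *)
rewrite -(ler_pM2l cardA_gt0).
have : \sum_(a in A) (1 - delta) `^ s <=
    \sum_(a in A) #|A|%:R * \sum_(i <- r | hits i a) rad i `^ s.
  exact: ler_sum.
rewrite sumr_const -[_ *+ _]mulr_natl -mulr_sumr => /le_trans; apply.
rewrite ler_pM2l// (exchange_big_dep predT)//= big_seq [leRHS]big_seq.
apply: ler_sum => i ir.
have [/existsP[a /andP[aA ha]]|/existsPn none] :=
    boolP [exists a, (a \in A) && hits i a].
  rewrite (bigD1 a) /= ?aA// big1 ?addr0// => b /andP[/andP[_ hb]].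
  by rewrite (hits_inj i b a)// eqxx.
by rewrite big1 ?powR_ge0// => a aA; have := none a; rewrite aA.
Qed.

Lemma hausdorff_measure_neq0 (t : R) :
  0 <= t < dimF -> hausdorff_measure t F <> 0%E.
Proof.
move=> /andP[t0 ts] H0; set s := dimF in ts.
have s0 : 0 < s by exact: le_lt_trans ts.
have d1 : 0 < 1 - delta by rewrite subr_gt0.
(* Chosen so that [3]^ s * (e + e)[is half of](1 - delta) [^ s]: one [e] is for the cover, the other
   for its fattening. *)
pose e : R := (1 - delta) `^ s / (3 `^ s * 4).
have e0 : 0 < e by rewrite divr_gt0 ?mulr_gt0 ?powR_gt0.
have : (hausdorff_premeasure t 1 F < e%:E)%E.
  by rewrite (hausdorff_measure_eq0 t F).1.
move=> /ereal_inf_lt[_ [U [UF U1] <-]] Ue.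
pose D n := fine (ediam (U n)).
have DE n : U n !=set0 -> [/\ ediam (U n) = (D n)%:E, 0 <= D n & D n <= 1].
  move=> Un; have ge0 := ediam_ge0 _ Un; have le1 := U1 n.
  have fU : ediam (U n) \is a fin_num.
    by rewrite ge0_fin_numE// (le_lt_trans le1)// ltry.
  by rewrite -!lee_fin /D fineK.
pose q n := fine (diam_pow t (U n)).
have qE n : diam_pow t (U n) = (q n)%:E.
  rewrite /q /diam_pow; case: ifPn => // /set0P/DE[-> _ _].
  by rewrite poweR_EFin.
have q0 n : 0 <= q n by rewrite -lee_fin -qE diam_pow_ge0.
have D0 n : 0 <= D n.
  have [Un|/set0P/DE[]//] := eqVneq (U n) set0.
  by rewrite /D /ediam Un setX0 image_set0 ereal_sup0.
(* Diameters are at most 1 and [t < s]. Diameter 0 is treated apart: there the left side is 0 as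
   [s > 0], whatever the convention at [t = 0]. *)
have Dq n : D n `^ s <= q n.
  have [Un|/[dup] Un /set0P/DE[De Dn0 Dn1]] := eqVneq (U n) set0.
    rewrite /D /ediam Un setX0 image_set0 ereal_sup0 /= powR0 ?gt_eqF//.
  rewrite -lee_fin -qE /diam_pow (negbTE Un) De poweR_EFin lee_fin.
  have [->|Dn] := eqVneq (D n) 0; first by rewrite powR0 ?powR_ge0 ?gt_eqF.
  by rewrite ger_powR ?(ltW ts)// Dn1 lt_def Dn Dn0.
(* The sets of the cover are fattened to open ones, the [n]-th by
   [max (D n) (tau n)], which costs a factor [3 ^ s] and the summable error
   [tau n ^ s = e / 2 ^ n.+1]. *)
pose tau n : R := (e / 2 ^+ n.+1) `^ s^-1.
have tau0 n : 0 < tau n by rewrite powR_gt0// divr_gt0// exprn_gt0.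
have tauE n : tau n `^ s = e / 2 ^+ n.+1.
  rewrite -powRrM mulVf ?gt_eqF// powRr1// divr_ge0 ?exprn_ge0// ltW//.
pose eta n := Num.max (D n) (tau n).
have eta0 n : 0 < eta n by rewrite lt_max tau0 orbT.
pose O n := \bigcup_(x in U n) ball x (eta n).
have [_ cF _] := hF; move: cF; rewrite compact_cover => cF.
have [r ur rF] : exists2 r : seq nat, uniq r &
    forall x, F x -> exists2 i, i \in r & O i x.
  have [||r _ rF] := cF nat setT O.
  - by move=> n _; apply: bigcup_open => x _; exact: ball_open.
  - by move=> x /UF[n _ Unx]; exists n => //; exists x => //; exact: ballxx.
  exists (finmap.enum_fset r); first exact: finmap.fset_uniq.
  by move=> x /rF[i ir Oi]; exists i.
(* Two points of [O n] are within [eta n] of points of [U n], which are themselves at most [eta n]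
   apart. *)
pose rad n := 3 * eta n.
(* Finitely many positive radii admit a common depth for [finite_cover_sum]. *)
have [M rM] : exists M, forall i, i \in r -> c ^+ M * (1 - delta) <= rad i.
  elim: {ur rF} r => [|i l [M lM]]; first by exists 0%N.
  have [n cn] : exists n, c ^+ n < eta i.
    by apply: exists_expr_lt; rewrite ?(ltW c0).
  exists (M + n)%N => j; rewrite inE => /predU1P[->|/lM h].
    have : c ^+ (M + n) * (1 - delta) <= 1 * c ^+ n * 1.
      rewrite exprD ler_pM ?mulr_ge0 ?exprn_ge0 ?(ltW c0) ?(ltW d1)//.
        by rewrite ler_wpM2r ?exprn_ge0 ?(ltW c0)// exprn_ile1// ltW.
      by rewrite lerBlDr lerDl ltW.
    by rewrite /rad; have := eta0 i; lra.
  apply: le_trans h; rewrite exprD ler_wpM2r ?(ltW d1)//.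
  by rewrite ler_piMr ?exprn_ge0 ?exprn_ile1 ?(ltW c0) ?(ltW c1).
have := finite_cover_sum s M r O rad (ltW s0) card_powR_dim rM.
have Orad i x y j : i \in r -> O i x -> O i y ->
    `|x 0 j - y 0 j| <= rad i.
  move=> _ [u Uu [_ /(_ 0 j) ux]] [v Uv [_ /(_ 0 j) vy]].
  have uv : `|u 0 j - v 0 j| <= eta i.
    have [De _ _] : [/\ ediam (U i) = (D i)%:E, 0 <= D i & D i <= 1].
      by apply: DE; exists u.
    have := le_ediam _ _ _ Uu Uv; rewrite De lee_fin => uv.
    rewrite le_max; apply/orP; left; apply: le_trans uv.
    by apply: le_trans (coord_le_enorm _ j); rewrite !mxE.
  rewrite /rad; move: uv ux vy; rewrite /ball/= !ltr_norml !ler_norml.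
  by move=> /andP[? ?] /andP[? ?] /andP[? ?]; apply/andP; split; lra.
move=> /(_ Orad) h.
have : (1 - delta) `^ s <= \sum_(i <- r) rad i `^ s.
  exact: h rF.
have radq i : rad i `^ s <= 3 `^ s * (q i + e / 2 ^+ i.+1).
  rewrite powRM ?(ltW (eta0 i))// ler_wpM2l ?powR_ge0//.
  rewrite /eta; case: (leP (D i) (tau i)) => _.
    by rewrite tauE lerDr.
  by apply: le_trans (Dq i) _; rewrite lerDl -tauE powR_ge0.
(* Bounding the indices compares the sum over the subcover with a partial sum of the series. *)
have rn : exists n, forall i, i \in r -> (i < n)%N.
  exists (\max_(i <- r) i).+1 => i ir; rewrite ltnS.
  exact: leq_bigmax_seq.
have [n {}rn] := rn.
have : \sum_(i <- r) rad i `^ s <=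
    3 `^ s * (\sum_(0 <= i < n) q i + \sum_(0 <= i < n) e / 2 ^+ i.+1).
  apply: le_trans (ler_sum _ (fun i _ => radq i)) _.
  rewrite -[leLHS]mulr_sumr ler_wpM2l ?powR_ge0// -big_split/=.
  apply: ler_sum_uniq => // i.
  by rewrite addr_ge0// -tauE powR_ge0.
have : \sum_(0 <= i < n) q i < e.
  rewrite -lte_fin; apply: le_lt_trans Ue; rewrite -sumEFin.
  under eq_bigr do rewrite -qE.
  by apply: nneseries_lim_ge => *; exact: diam_pow_ge0.
have := sum_half_lt e n e0.
move: (\sum_(0 <= i < n) q i) (\sum_(0 <= i < n) _) => S1 S2 S2e S1e h1 h2.
have : 3 `^ s * (S1 + S2) < 3 `^ s * (e + e).
  by rewrite ltr_pM2l ?powR_gt0// ltrD.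
have -> : 3 `^ s * (e + e) = (1 - delta) `^ s / 2.
  by rewrite /e; field; rewrite gt_eqF// powR_gt0.
have : 0 < (1 - delta) `^ s by rewrite powR_gt0.
by move: (powR _ _) (\sum_(i <- _) _) h1 h2 => *; lra.
Qed.

End HausdorffDimension.

(** * Upper bound and value of the Hausdorff dimension *)

Section HausdorffUpperBound.
Context {R : realType} {N d : nat} {delta : R}.
Hypotheses (N1 : (1 < N)%N) (delta0 : 0 < delta) (delta1 : delta < 1).
Local Notation c := (delta / (N%:R - 1 + delta)).
Local Notation L := (N%:R - 1 + delta).
Context {A : {set 'rV['I_N]_d}} {F : set 'rV[R]_d}.
Hypothesis hF : is_attractor [set phi delta a | a in [set` A]] F.
Local Notation dimF := (ln (#|A|%:R) / ln ((N%:R - 1) / delta + 1)).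
(** Bounds the diameter of [F]; the summand 1 makes it positive in every dimension, including
    [d = 0]. *)
Local Notation D := (Num.sqrt d%:R * L + 1).

Let c0 : 0 < c := ratio_gt0 N1 delta0 delta1.
Let c1 : c < 1 := ratio_lt1 N1 delta0 delta1.

Lemma cylinder_cover n : exists l : seq (set 'rV[R]_d),
  [/\ size l = (#|A| ^ n)%N,
  (forall x, F x -> exists2 V, V \in l & V x) &
  (forall V, V \in l -> forall x y, V x -> V y -> enorm (x - y) <= c ^+ n * D)].
Proof.
elim: n => [|n [l [sl lF lD]]].
  exists [:: F]; split=> [//|x Fx|V]; first by exists F; rewrite ?mem_head.
  rewrite inE => /eqP -> x y Fx Fy; rewrite expr0 mul1r.
  have L0 : 0 <= L.
    have [? ? ?] := param_bounds N1 delta0 delta1; lra.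
  apply: le_trans (enorm_le _ L L0 _) _; last by rewrite lerDl.
  move=> j; rewrite !mxE.
  have /andP[? ?] := attractor_box N1 delta0 delta1 hF _ Fx j.
  have /andP[? ?] := attractor_box N1 delta0 delta1 hF _ Fy j.
  by rewrite ler_norml; apply/andP; split; lra.
exists [seq phi delta a @` V | a <- enum A, V <- l]; split.
- by rewrite size_allpairs sl -cardE expnS.
- move=> x /(attractor_digit hF)[a [y [aA /lF[V Vl Vy] ->]]].
  exists (phi delta a @` V); last by exists y.
  by apply: allpairs_f; rewrite ?mem_enum.
- move=> _ /allpairsP[[a V] /= [_ Vl ->]] _ _ [x Vx <-] [y Vy <-].
  rewrite phi_sub enormZ gtr0_norm// exprS -mulrA ler_pM2l//.
  exact: lD Vl _ _ Vx Vy.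
Qed.

(** The level-[n] copies contribute at most [z ^+ n * D]^ t[with]z = #|A| * c [^ t], and [z < 1]
    because [c < 1] and [t] exceeds the solution of Moran's equation. *)
Lemma hausdorff_measure_eq0_gt (t : R) :
  dimF < t -> hausdorff_measure t F = 0%E.
Proof.
move=> st; have t0 : 0 < t.
  by apply: le_lt_trans st; exact (dim_ge0 N1 delta0 delta1 hF).
have D0 : 0 < D.
  have [? ? ?] := param_bounds N1 delta0 delta1.
  by rewrite ltr_wpDl// mulr_ge0//; lra.
pose z := #|A|%:R * c `^ t.
have z01 : 0 <= z < 1.
  rewrite mulr_ge0 ?powR_ge0//=.
  rewrite /z -[t](subrK dimF) powRD ?(gt_eqF c0) ?implybT// mulrCA.
  rewrite (card_powR_dim N1 delta0 delta1 hF) mulr1.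
  apply: (@lt_le_trans _ _ (1 `^ (t - dimF))); last by rewrite powR1.
  by rewrite gt0_ltr_powR ?subr_gt0 ?nnegrE// ltW.
apply/hausdorff_measure_eq0 => rho rho0; apply/eqP; rewrite eq_le.
rewrite hausdorff_premeasure_ge0 andbT.
apply/lee_addgt0Pr => e e0; rewrite add0e.
have Dt0 : 0 < D `^ t by rewrite powR_gt0.
have [n1 zn] : exists n, z ^+ n < e / D `^ t.
  by apply: exists_expr_lt; rewrite // divr_gt0.
have [n2 cn] : exists n, c ^+ n < rho / D.
  by apply: exists_expr_lt; rewrite ?(ltW c0)// divr_gt0.
(* [n1] makes the sum small and [n2] the diameters; both bounds persist at deeper levels. *)
pose n := (n1 + n2)%N.
have {}zn : z ^+ n * D `^ t <= e.
  have /andP[z0 z1] := z01.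
  rewrite -ler_pdivlMr//; apply: le_trans (ltW zn).
  by rewrite exprD ler_piMr ?exprn_ge0// exprn_ile1// ltW.
have {}cn : c ^+ n * D <= rho.
  rewrite -ler_pdivlMr//; apply: le_trans (ltW cn).
  by rewrite exprD ler_piMl ?exprn_ge0 ?exprn_ile1 ?(ltW c0) ?(ltW c1).
have [l [sl lF lD]] := cylinder_cover n.
have diamU V : V \in l -> (ediam V <= (c ^+ n * D)%:E)%E.
  move=> Vl; apply: ge_ereal_sup => _ [[x y] [/= Vx Vy] <-].
  by rewrite lee_fin; exact: lD Vl _ _ Vx Vy.
(* The finite cover is continued by empty sets, of diameter [-oo] and contribution 0. *)
pose U i := nth set0 l i.
apply: (@le_trans _ _ (\sum_(i <oo) diam_pow t (U i))%E).
  apply: ereal_inf_lbound; exists U => //; split.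
    move=> x /lF[V Vl Vx]; exists (index V l) => //.
    by rewrite /U nth_index.
  move=> i; have [il|li] := ltnP i (size l).
    by apply: le_trans (diamU _ (mem_nth _ il)) _; rewrite lee_fin.
  by rewrite /U nth_default// /ediam setX0 image_set0 ereal_sup0 leNye.
apply: lime_le; first by apply: is_cvg_nneseries => *; exact: diam_pow_ge0.
exists (size l) => // k /= lk.
rewrite (big_cat_nat (n := size l))//=.
rewrite [X in (_ + X)%E]big_nat_cond [X in (_ + X)%E]big1; last first.
  by move=> i /andP[/andP[li _] _]; rewrite /U nth_default// /diam_pow eqxx.
rewrite adde0.
apply: (@le_trans _ _ (\sum_(0 <= i < size l) ((c ^+ n * D) `^ t)%:E)%E).
  rewrite big_nat_cond [leRHS]big_nat_cond.
  apply: lee_sum => i /andP[/andP[_ il] _]; rewrite /diam_pow.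
  case: ifPn => [_|/set0P Un]; first by rewrite lee_fin powR_ge0.
  rewrite -poweR_EFin; apply: (gt0_ler_poweR (ltW t0)).
  - by rewrite in_itv/= ediam_ge0 ?leey.
  - by rewrite in_itv/= leey andbT lee_fin mulr_ge0 ?exprn_ge0// ltW.
  - exact/diamU/mem_nth.
rewrite sumEFin lee_fin sumr_const_nat subn0 sl; apply: le_trans zn.
rewrite powRM ?exprn_ge0 ?(ltW c0) ?(ltW D0)// -[leLHS]mulr_natl natrX mulrA.
rewrite ler_pM2r//.
by rewrite -powR_mulrn ?(ltW c0)// powRAC powR_mulrn ?powR_ge0// -exprMn.
Qed.

Lemma hausdorff_dim_attractor : hausdorff_dim F = dimF%:E.
Proof.
apply/eqP; rewrite eq_le; apply/andP; split.
  (* The measure is known to vanish only above [dimF], so [dimF + e] is tested. *)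
  apply/lee_addgt0Pr => e e0; apply: ereal_inf_lbound.
  exists (dimF + e); last by rewrite EFinD.
  split; last by apply: hausdorff_measure_eq0_gt; rewrite ltrDl.
  by rewrite addr_ge0 ?(ltW e0)// (dim_ge0 N1 delta0 delta1 hF).
apply: le_ereal_inf_tmp => _ [t [t0 Ht] <-]; rewrite lee_fin leNgt.
apply/negP => tdim; apply: (hausdorff_measure_neq0 N1 delta0 delta1 hF t) Ht.
by rewrite t0.
Qed.

End HausdorffUpperBound.

Theorem theorem2p2 (R : realType) (k d m : nat)
    (hk : (2 <= k)%N) (hd : (1 <= d)%N) (hm : (1 <= m)%N) (hmd : (m <= d)%N)
    (hk3 : d = 1%N -> (3 <= k)%N)
    (eps : R) (heps0 : 0 < eps) (heps : eps < 1 / 8)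
    (N : nat) (hN : N%:Z = Num.ceil (1 / (8 * eps)))
    (delta : R) (hdelta0 : 0 < delta) (hdelta : delta <= 1 / 24)
    (A : {set 'rV['I_N]_d}) (hA0 : exists a, a \in A)
    (hA : ~ contains_patch k (std_orientation R hmd)
              [set grid_point R a | a in [set` A]])
    (F : set 'rV[R]_d)
    (hF : is_attractor [set phi delta a | a in [set` A]] F) :
  [/\ is_IFS [set phi delta a | a in [set` A]] /\
        open_set_condition [set phi delta a | a in [set` A]],
      ~ contains_AP k eps (std_orientation R hmd) F &
      hausdorff_dim F =
        (ln (#|A|%:R) / ln ((N%:R - 1) / delta + 1))%:E].
Proof.
have delta1 : delta < 1 by lra.
(* The upper bound on [N] gives [eps * (N - 1) < 1 / 8]; the lower one gives [N > 1], since
   [8 * eps < 1]. *)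
have /andP[Nlt Nge] : N%:R - 1 < 1 / (8 * eps) <= (N%:R : R).
  have -> : N%:R = (Num.ceil (1 / (8 * eps)))%:~R :> R by rewrite -hN.
  have := ceil_itv (1 / (8 * eps)); rewrite intrD; exact.
have N1 : (1 < N)%N.
  rewrite -(ltr_nat R); apply: lt_le_trans Nge.
  by rewrite ltr_pdivlMr; lra.
have epsN : eps * (N%:R - 1) < 1 / 8.
  by move: Nlt; rewrite ltr_pdivlMr ?mulr_gt0//; lra.
split.
- by split; [exact: phi_is_IFS|exact: phi_open_set_condition].
- exact (attractor_no_AP N1 hdelta0 hdelta hm hk epsN hF hA).
- exact (hausdorff_dim_attractor N1 hdelta0 delta1 hF).
Qed.
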